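(* Let $m\in\mathbb{N}$ with $m\geq 2$, let $\mathbb{X}$ be a Euclidean space, and let $f:\mathbb{X}\to\mathbb{R}$ and $F:\mathbb{X}\to\mathbb{S}^m$ be twice continuously differentiable. Consider the nonlinear semidefinite optimization problem $$\min\{f(x)\mid F(x)\in\mathbb{S}^m_+\}$$ with feasible set $\mathcal{F}:=\{x\in\mathbb{X}\mid F(x)\in\mathbb{S}^m_+\}$. Let $\bar x\in\mathcal{F}$ be such that for each $u\in\mathcal{C}(\bar x)\setminus\{0\}$ there are $\alpha\geq 0$ and $Y^*\in\Lambda^\alpha(\bar x,u)$ such that $$(\mathcal{L}^\alpha)''_{xx}(\bar x,Y^* )[u,u]>2\big\langle Y^*,(F'(\bar x)u)\,F(\bar x)^\dagger\,(F'(\bar x)u)\big\rangle.$$ Then $\bar x$ is an essential local minimizer of second order for this optimization problem, i.e., there are $\varepsilon>0$ and $\beta>0$ such that for all $x\in\mathbb{X}$ with $\|x-\bar x\|\leq\varepsilon$, $$\max\big(f(x)-f(\bar x),\ \operatorname{dist}_{\mathbb{S}^m_+}(F(x))\big)\geq\beta\|x-\bar x\|^2.$$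
   Context: A Euclidean space is a finite-dimensional real Hilbert space, with inner product $\langle\cdot,\cdot\rangle$ and induced norm $\|\cdot\|$. $\mathbb{S}^m$ is the Euclidean space of real symmetric $m\times m$ matrices with the Frobenius inner product $\langle A,B\rangle:=\operatorname{trace}(AB)$ and the induced norm; $\mathbb{S}^m_+\subset\mathbb{S}^m$ is the closed convex cone of positive semidefinite matrices. $Y^\dagger$ denotes the Moore--Penrose pseudoinverse of $Y$. The distance function is $\operatorname{dist}_{\mathbb{S}^m_+}(Z):=\inf\{\|W-Z\|\mid W\in\mathbb{S}^m_+\}$. For $V\in\mathbb{S}^m$, $\{V\}^\perp:=\{Z\in\mathbb{S}^m\mid\langle Z,V\rangle=0\}$. For $Y\in\mathbb{S}^m_+$, the tangent (Bouligand) cone is $$\mathcal{T}_{\mathbb{S}^m_+}(Y):=\{V\in\mathbb{S}^m\mid\exists\{t_k\}\subset(0,\infty),\ \exists\{V_k\}\subset\mathbb{S}^m:\ t_k\downarrow 0,\ V_k\to V,\ Y+t_kV_k\in\mathbb{S}^m_+\ \text{for all }k\in\mathbb{N}\},$$ and the normal cone is its polar, $\mathcal{N}_{\mathbb{S}^m_+}(Y):=\{Y^*\in\mathbb{S}^m\mid\langle Y^*,V\rangle\leq 0\text{ for all }V\in\mathcal{T}_{\mathbb{S}^m_+}(Y)\}$. $F'(x):\mathbb{X}\to\mathbb{S}^m$ denotes the (linear) first derivative of $F$ at $x$ and $F''(x)$ its (bilinear) second derivative; similarly for other functions and for partial derivatives. For $\alpha\geq 0$, the generalized Lagrangian is $$\mathcal{L}^\alpha(x,Y^*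 ):=\alpha f(x)+\langle Y^*,F(x)\rangle\qquad(x\in\mathbb{X},\ Y^*\in\mathbb{S}^m),$$ and $(\mathcal{L}^\alpha)'_x$, $(\mathcal{L}^\alpha)''_{xx}$ denote its first and second partial derivatives with respect to $x$. For $x\in\mathcal{F}$, the critical cone is $$\mathcal{C}(x):=\{u\in\mathbb{X}\mid f'(x)u\leq 0,\ F'(x)u\in\mathcal{T}_{\mathbb{S}^m_+}(F(x))\}.$$ For $u\in\mathcal{C}(x)$ and $\alpha\geq 0$, the directional Lagrange multiplier set is $$\Lambda^\alpha(x,u):=\{Y^*\in\mathcal{N}_{\mathbb{S}^m_+}(F(x))\cap\{F'(x)u\}^\perp\mid(\mathcal{L}^\alpha)'_x(x,Y^* )=0\}.$$ *)

(* Defs.v *)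
From HB Require Import structures.
From mathcomp Require Import all_boot all_order all_algebra.
From mathcomp Require Import ring.
From mathcomp Require Import boolp classical_sets reals topology normedtype derive.

Set Implicit Arguments.
Unset Strict Implicit.
Unset Printing Implicit Defensive.

Import Order.TTheory GRing.Theory Num.Theory.
Import numFieldNormedType.Exports.
Local Open Scope classical_set_scope.
Local Open Scope ring_scope.

HB.mixin Record NormedModule_hasInner (R : realType) V of NormedModule R V := {
  inner : V -> V -> R;
  innerC : forall x y, inner x y = inner y x;
  innerDl : forall x y z, inner (x + y) z = inner x z + inner y z;
  innerZl : forall (a : R) x y, inner (a *: x) y = a * inner x y;
  (* this also makes [inner] positive definite *)
  innerxx : forall x, inner x x = `|x| ^+ 2
}.

#[short(type="euclideanType")]
HB.structure Definition Euclidean (R : realType) :=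
  {V of NormedModule R V & Vector R V & NormedModule_hasInner R V}.

Section SymmetricMatrices.
Context {R : realType} {m : nat}.

Definition frob (A B : 'M[R]_m) : R := \tr (A *m B).

Definition sym_space : {vspace 'M[R]_m} := fixedSpace (linfun trmx).

Lemma sym_spaceP (A : 'M[R]_m) : reflect (A^T = A) (A \in sym_space).
Proof. by apply: (iffP fixedSpaceP); rewrite lfunE. Qed.

Definition sym : Type := subvs_of sym_space.

HB.instance Definition _ := Vector.on sym.

Definition sym_val (A : sym) : 'M[R]_m := vsval A.

Lemma sym_valT A : (sym_val A)^T = sym_val A.
Proof. by apply/sym_spaceP; exact: subvsP. Qed.

Lemma sym_val_inj : injective sym_val. Proof. exact: val_inj. Qed.

Lemma sym_val_is_linear : linear sym_val. Proof. by []. Qed.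

HB.instance Definition _ :=
  GRing.isLinear.Build R sym 'M[R]_m _ sym_val sym_val_is_linear.

Let ip (A B : sym) := frob (sym_val A) (sym_val B).

Let ipC A B : ip A B = ip B A. Proof. exact: mxtrace_mulC. Qed.

Let ipDl A B C : ip (A + B) C = ip A C + ip B C.
Proof. by rewrite /ip /frob linearD/= mulmxDl linearD. Qed.

Let ipZl a A B : ip (a *: A) B = a * ip A B.
Proof. by rewrite /ip /frob linearZ/= -scalemxAl linearZ. Qed.

Let ipE A : ip A A = \sum_i \sum_j sym_val A i j ^+ 2.
Proof.
rewrite /ip /frob /mxtrace; apply: eq_bigr => i _; rewrite mxE.
by apply: eq_bigr => j _; rewrite -{2}(sym_valT A) mxE expr2.
Qed.

Let ip_ge0 A : 0 <= ip A A.
Proof. by rewrite ipE; do 2![apply: sumr_ge0 => ? _]; exact: sqr_ge0. Qed.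

Let ip_eq0 A : ip A A = 0 -> A = 0.
Proof.
rewrite ipE => /eqP; rewrite psumr_eq0; last first.
  by move=> i _; apply: sumr_ge0 => j _; exact: sqr_ge0.
move=> /allP A0; apply: sym_val_inj; rewrite linear0; apply/matrixP => i j.
have := A0 i (mem_index_enum i); rewrite /= psumr_eq0; last first.
  by move=> k _; exact: sqr_ge0.
move=> /allP /(_ j (mem_index_enum j)) /=.
by rewrite sqrf_eq0 mxE => /eqP.
Qed.

Let ip_CS A B : ip A B <= Num.sqrt (ip A A) * Num.sqrt (ip B B).
Proof.
have [b0|b0] := eqVneq (ip B B) 0.
  have -> : B = 0 by exact: ip_eq0.
  by rewrite ipC /ip /frob linear0 mul0mx linear0 mulr_ge0// sqrtr_ge0.
have bp : 0 < ip B B by rewrite lt_neqAle eq_sym b0 ip_ge0.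
rewrite -sqrtrM ?ip_ge0//; apply: le_trans (ler_norm _) _.
rewrite -sqrtr_sqr ler_sqrt ?mulr_ge0 ?ip_ge0//.
have := ip_ge0 (ip B B *: A - ip A B *: B).
rewrite -[- _]scaleNr ipDl !ipZl ![ip _ (_ + _)]ipC !ipDl !ipZl (ipC B A).
rewrite (_ : _ + _ = ip B B * (ip A A * ip B B - ip A B ^+ 2)); last by ring.
by rewrite pmulr_rge0// subr_ge0.
Qed.

Let nrm A : R := Num.sqrt (ip A A).

Let nrmD A B : nrm (A + B) <= nrm A + nrm B.
Proof.
rewrite /nrm -[leRHS]ger0_norm ?addr_ge0 ?sqrtr_ge0// -sqrtr_sqr.
rewrite ler_sqrt ?sqr_ge0// sqrrD !sqr_sqrtr ?ip_ge0//.
rewrite ipDl !(ipC _ (A + B)) !ipDl (ipC B A) addrA -[X in X + _]addrA lerD2r.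
by rewrite lerD2l -mulr2n lerMn2r ip_CS orbT.
Qed.

Let nrmZ a A : nrm (a *: A) = `|a| * nrm A.
Proof.
by rewrite /nrm ipZl ipC ipZl mulrA -expr2 sqrtrM ?sqr_ge0// sqrtr_sqr.
Qed.

Let nrm_eq0 A : nrm A = 0 -> A = 0.
Proof.
move=> /eqP; rewrite sqrtr_eq0 => A0.
by apply: ip_eq0; apply/eqP; rewrite eq_le A0 ip_ge0.
Qed.

HB.instance Definition _ := Lmodule_isNormed.Build R sym nrmD nrmZ nrm_eq0.

Let ipxx (A : sym) : ip A A = `|A| ^+ 2.
Proof. by rewrite [`|A|]/(nrm A) sqr_sqrtr ?ip_ge0. Qed.

HB.instance Definition _ :=
  NormedModule_hasInner.Build R sym ipC ipDl ipZl ipxx.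

Lemma inner_symE (A B : sym) : inner A B = frob (sym_val A) (sym_val B).
Proof. by []. Qed.

Definition psd_cone : set sym :=
  [set A | forall v : 'cV[R]_m, 0 <= (v^T *m sym_val A *m v) 0 0].

End SymmetricMatrices.
Arguments sym : clear implicits.
Arguments sym_space : clear implicits.

Notation "''Sym[' R ]_ m" := (sym R m)
  (at level 8, m at level 2, format "''Sym[' R ]_ m") : type_scope.

Section PseudoInverse.
Context {R : realType} {m : nat}.
Implicit Types A B : 'M[R]_m.

Definition is_moore_penrose A B : Prop :=
  [/\ A *m B *m A = A, B *m A *m B = B,
      (A *m B)^T = A *m B & (B *m A)^T = B *m A].

(* not the library's [pinvmx], which is only a partial inverse *)
Definition moore_penrose A : 'M[R]_m := get (is_moore_penrose A).

Lemma is_moore_penrose_uniq A B C :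
  is_moore_penrose A B -> is_moore_penrose A C -> B = C.
Proof.
move=> [ABA BAB AB BA] [ACA CAC AC CA].
have E1 : A *m B = A *m C.
  transitivity ((A *m B *m (A *m C))^T); last by rewrite mulmxA ABA.
  by rewrite trmx_mul AC AB mulmxA ACA.
have E2 : B *m A = C *m A.
  transitivity ((C *m A *m (B *m A))^T).
    by rewrite trmx_mul BA CA -mulmxA (mulmxA A) ACA.
  by rewrite -mulmxA (mulmxA A) ABA.
by rewrite -BAB -mulmxA E1 mulmxA E2 CAC.
Qed.

Let gram_unit n r (C : 'M[R]_(n, r)) : row_free C^T -> C^T *m C \in unitmx.
Proof.
move=> C_free; rewrite -row_free_unit -kermx_eq0; apply/rowV0P => v /sub_kermxP.
rewrite mulmxA => vCC; apply/eqP; rewrite -(mulmx_free_eq0 _ C_free).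
set w := v *m C^T.
have /eqP : (w *m w^T) 0 0 = 0.
  by rewrite /w trmx_mul trmxK mulmxA vCC mul0mx mxE.
have w2 j : w 0 j * w^T j 0 = w 0 j ^+ 2 by rewrite [w^T j 0]mxE expr2.
rewrite mxE psumr_eq0 => [/allP w0|j _]; last by rewrite w2 sqr_ge0.
apply/eqP/rowP => j; have := w0 j (mem_index_enum j).
by rewrite /= w2 sqrf_eq0 => /eqP ->; rewrite mxE.
Qed.

Let moore_penrose_factor r (C : 'M[R]_(m, r)) (D : 'M[R]_(r, m)) :
  row_free C^T -> row_free D -> exists B, is_moore_penrose (C *m D) B.
Proof.
move=> C_free D_free; have uC := gram_unit C_free.
have uD : D *m D^T \in unitmx.
  by rewrite -[X in X *m _]trmxK; apply: gram_unit; rewrite trmxK.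
pose P := invmx (C^T *m C) *m C^T; pose Q := D^T *m invmx (D *m D^T).
have PC : P *m C = 1%:M by rewrite -mulmxA mulVmx.
have DQ : D *m Q = 1%:M by rewrite mulmxA mulmxV.
have AB : C *m D *m (Q *m P) = C *m P by rewrite -mulmxA (mulmxA D) DQ mul1mx.
have BA : Q *m P *m (C *m D) = Q *m D by rewrite -mulmxA (mulmxA P) PC mul1mx.
exists (Q *m P); split.
- by rewrite AB -mulmxA (mulmxA P) PC mul1mx.
- by rewrite BA -mulmxA (mulmxA D) DQ mul1mx.
- by rewrite AB !trmx_mul trmx_inv trmx_mul trmxK mulmxA.
- by rewrite BA !trmx_mul trmx_inv trmx_mul trmxK mulmxA.
Qed.

Lemma moore_penroseP A : is_moore_penrose A (moore_penrose A).
Proof.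
suff [B AB] : exists B, is_moore_penrose A B by exact: (getI AB).
rewrite -[X in is_moore_penrose X](mulmx_base A).
apply: moore_penrose_factor; last exact: row_base_free.
by rewrite /row_free mxrank_tr; exact: col_base_full.
Qed.

End PseudoInverse.

Section Derivatives.
Context {R : realType} {X : euclideanType R} {W : normedModType R}.

Definition diff2 (g : X -> W) (x u v : X) : W := 'd (fun y => 'd g y v) x u.

(* As [X] is finite-dimensional, the convergence of linear and bilinear maps
   on [X] is pointwise convergence, so the derivatives can be tested on fixed
   directions. *)
Definition twice_continuously_differentiable (g : X -> W) : Prop :=
  [/\ forall x, differentiable g x,
      forall v x, differentiable (fun y => 'd g y v) x &
      forall u v, continuous (fun x => diff2 g x u v)].

End Derivatives.

Section Cones.
Context {R : realType}.

Definition tangent_cone (V : normedModType R) (S : set V) (y : V) : set V :=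
  [set v | exists (t : nat -> R) (w : nat -> V),
    [/\ forall k, 0 < t k, t @ \oo --> (0 : R), w @ \oo --> v &
        forall k, S (y + t k *: w k)]].

Definition normal_cone (V : euclideanType R) (S : set V) (y : V) : set V :=
  [set z | forall v, tangent_cone S y v -> inner z v <= 0].

Definition distance (V : normedModType R) (S : set V) (z : V) : R :=
  inf [set `|w - z| | w in S].

End Cones.

Section SemidefiniteProgram.
Context {R : realType} {m : nat} {X : euclideanType R}.
Variables (f : X -> R) (F : X -> 'Sym[R]_m).

Definition feasible_set : set X := [set x | psd_cone (F x)].

Definition critical_cone (x : X) : set X :=
  [set u | 'd f x u <= 0 /\ tangent_cone psd_cone (F x) ('d F x u)].

Definition lagrangian (alpha : R) (x : X) (Y : 'Sym[R]_m) : R :=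
  alpha * f x + inner Y (F x).

Definition multipliers (alpha : R) (x u : X) : set 'Sym[R]_m :=
  [set Y | [/\ normal_cone psd_cone (F x) Y, inner Y ('d F x u) = 0 &
    forall v, 'd (fun z => lagrangian alpha z Y) x v = 0]].

End SemidefiniteProgram.

(* Main.v *)
Require Import Defs.
From HB Require Import structures.
From mathcomp Require Import all_boot all_order all_algebra.
From mathcomp Require Import ring.
From mathcomp Require Import boolp classical_sets functions reals topology.
From mathcomp Require Import normedtype landau sequences derive.
Import Order.TTheory GRing.Theory Num.Theory.
Import numFieldNormedType.Exports.
Import VectorInternalTheory.
Local Open Scope classical_set_scope.
Local Open Scope ring_scope.

(** The growth bound is local in the direction of approach. Were it to fail
    near a unit direction [u], there would be points [x_k = xbar + t_k w_k]
    with [w_k --> u] and [t_k --> 0], and positive semidefinite [W_k], such that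
    both [f x_k - f xbar] and [|W_k - F x_k|] are [o(t_k^2)] (the first one only
    from above). First-order expansion shows that [u] is critical, so it comes
    with a multiplier [Y]. Two bounds on [<Y, W_k> / t_k^2] then collide.

    - From below: the Lagrangian is stationary at [xbar], so that
      [L x_k - L xbar] is [t_k^2 / 2 * L''[u, u]] up to [o(t_k^2)]
      ([second_order_quotient_cvg]), and the [f]-part of this increment is
      negligible from above. Hence the lower limit is at least [L''[u, u] / 2].

    - From above: write [A = F xbar], [V = F'(xbar) u] and [A^+] for the
      pseudoinverse. The matrix [M^T W_k M] with [M = 1 - t_k A^+ V] is positive
      semidefinite, so [<Y, M^T W_k M> <= 0]. Expanding in [t_k] and cancelling
      with [<Y, A B> = 0] for all [B] ([normal_frob_mul0]) bounds the upper
      limit by [<Y, V A^+ V>] ([normal_second_order_limit]). This choice of [M]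
      eliminates, to first order, the off-diagonal blocks of [W_k] with respect
      to the range and kernel of [A]: it is the Schur complement argument
      without a block decomposition.

    Together they give [L''[u, u] <= 2 <Y, V A^+ V>], against the assumption.
    Compactness of the unit sphere makes the local constants uniform. *)

(** * Topology of finite-dimensional spaces *)

Lemma cvg_fin_sum {R : realType} {W : normedModType R} (I : finType) {T : Type}
    (G : set_system T) {GG : Filter G} (h : I -> T -> W) (l : I -> W) :
  (forall i, h i x @[x --> G] --> l i) ->
  \sum_i h i x @[x --> G] --> \sum_i l i.
Proof. by move=> hl; apply: cvg_big => //; exact: add_continuous. Qed.

Lemma harmonic_cvg0 {R : realType} :
  (fun k => k.+1%:R^-1 : R) @ \oo --> (0 : R).
Proof. exact: cvg_harmonic. Qed.

Section FiniteDimension.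
Context {R : realType} {V : euclideanType R}.

Lemma r2v_sum (r : 'rV[R]_(dim V)) :
  r2v r = \sum_i r 0 i *: r2v (delta_mx 0 i) :> V.
Proof.
rewrite [r in LHS]row_sum_delta linear_sum; apply: eq_bigr => i _.
by rewrite linearZ.
Qed.

Lemma r2v_continuous : continuous (r2v : 'rV[R]_(dim V) -> V).
Proof.
move=> r; rewrite (_ : r2v = fun s => \sum_i s 0 i *: r2v (delta_mx 0 i)).
  by apply: (@cvg_fin_sum _ _ _ _ (nbhs r) _) => i; apply: cvgZr_tmp;
    exact: coord_continuous.
by apply/funext => s; exact: r2v_sum.
Qed.

Lemma norm_r2v_continuous : continuous (fun r : 'rV[R]_(dim V) => `|r2v r : V|).
Proof.
move=> r; exact: (continuous_comp (r2v_continuous r) (@norm_continuous _ _ _)).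
Qed.

(** The nontrivial half of the equivalence of norms: [|r2v r|] is continuous
    and nonzero on the compact unit sphere for the sup norm, hence bounded away
    from zero there, and homogeneity does the rest. *)
Lemma r2v_norm_ge :
  exists2 c : R, 0 < c & forall r : 'rV[R]_(dim V), c * `|r| <= `|r2v r : V|.
Proof.
have cptS : compact [set r : 'rV[R]_(dim V) | `|r| = 1].
  apply: bounded_closed_compact.
    exists 1; split; first exact: num_real.
    by move=> M M1 r /= ->; exact: ltW.
  apply: (@closed_comp _ _ (fun r : 'rV[R]_(dim V) => `|r|) [set 1]).
    by move=> r _; exact: norm_continuous.
  exact: closed_eq.
have /compact_near_coveringP cov := cptS.
have : \forall c \near (0 : R)^'+,
    [set r : 'rV[R]_(dim V) | `|r| = 1] `<=` (fun r => c < `|r2v r : V|).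
  apply: cov => r /= r1.
  have r2v_gt0 : 0 < `|r2v r : V|.
    rewrite normr_gt0; apply/eqP => r0.
    have : r = 0 by apply: (can_inj (@r2vK R V)); rewrite r0 linear0.
    by move=> re; move: r1; rewrite re normr0 => /esym/eqP; rewrite oner_eq0.
  exists ([set s : 'rV[R]_(dim V) | `|r2v r : V| / 2 < `|r2v s : V|],
          [set c | c < `|r2v r : V| / 2]) => /=; last first.
    by move=> [s c] /= [sr cr]; exact: lt_trans cr sr.
  split; last by apply: nbhs_right_lt; rewrite divr_gt0.
  apply: (cvgr_gt _ (norm_r2v_continuous r)).
  by rewrite ltr_pdivrMr// ltr_pMr// ltr1n.
move=> cS; near (0 : R)^'+ => c; exists c => // r.
have [->|r0] := eqVneq r 0; first by rewrite normr0 mulr0.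
have rp : 0 < `|r| by rewrite normr_gt0.
have : c < `|r2v (`|r|^-1 *: r) : V|.
  have : [set r : 'rV[R]_(dim V) | `|r| = 1] `<=` (fun r => c < `|r2v r : V|).
    by near: c.
  by apply; rewrite /= normrZ normfV normr_id mulVf// gt_eqF.
rewrite linearZ normrZ normfV normr_id mulrC ltr_pdivlMr// => h.
exact: ltW.
Unshelve. all: by end_near. Qed.

Lemma v2r_continuous : continuous (v2r : V -> 'rV[R]_(dim V)).
Proof.
have [c c0 cP] := r2v_norm_ge.
apply: bounded_linear_continuous; apply/linear_boundedP.
exists c^-1; split; first exact: num_real.
move=> M cM v; apply: le_trans (_ : c^-1 * `|v| <= _).
  by rewrite mulrC ler_pdivlMr// mulrC; have := cP (v2r v); rewrite v2rK.
by rewrite ler_wpM2r// ltW.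
Qed.

Lemma linear_continuous_findim {W : normedModType R} (h : {linear V -> W}) :
  continuous h.
Proof.
move=> v.
rewrite (_ : h = (fun x => \sum_i v2r x 0 i *: h (r2v (delta_mx 0 i)))
  :> (V -> W)).
  apply: (@cvg_fin_sum _ _ _ _ (nbhs v) _) => i; apply: cvgZr_tmp.
  exact: (continuous_comp (v2r_continuous v) (@coord_continuous _ _ _ _ _ _)).
apply/funext => x; rewrite -[x in LHS]v2rK r2v_sum linear_sum.
by apply: eq_bigr => i _; rewrite linearZ.
Qed.

Lemma compact_unit_sphere : compact [set v : V | `|v| = 1].
Proof.
have -> : [set v : V | `|v| = 1] =
    r2v @` [set r : 'rV[R]_(dim V) | `|r2v r : V| = 1].
  apply/seteqP; split=> [v v1|_ [r r1 <-]//].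
  by exists (v2r v); rewrite /= v2rK.
apply: continuous_compact.
  by apply: continuous_subspaceT; exact: r2v_continuous.
apply: bounded_closed_compact.
  have [c c0 cP] := r2v_norm_ge.
  exists c^-1; split; first exact: num_real.
  move=> M cM r /= r1; apply: le_trans (ltW cM).
  by have := cP r; rewrite r1 mulrC -ler_pdivlMr// mul1r.
apply: (@closed_comp _ _ (fun r : 'rV[R]_(dim V) => `|r2v r : V|) [set 1]).
  by move=> r _; exact: norm_r2v_continuous.
exact: closed_eq.
Qed.

End FiniteDimension.

(** * First- and second-order difference quotients along moving directions *)

Section Calculus.
Context {R : realType} {V : euclideanType R} {W : normedModType R}.

(** Frechet differentiability makes the remainder uniform in the direction,
    so the direction may vary with the step. *)
Lemma diff_quotient_cvg (g : V -> W) (x u : V) (t : nat -> R) (w : nat -> V) :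
  differentiable g x -> (forall k, 0 < t k) -> t @ \oo --> (0 : R) ->
  w @ \oo --> u ->
  (t k)^-1 *: (g (x + t k *: w k) - g x) @[k --> \oo] --> 'd g x u.
Proof.
move=> dg t0 tcvg wcvg.
have tw0 : (fun k => t k *: w k) @ \oo --> (0 : V).
  by rewrite -(scale0r u); exact: cvgZ.
rewrite -[X in _ --> X]add0r.
rewrite (_ : (fun k => _) = (fun k =>
   ((t k)^-1 *: (g (x + t k *: w k) - g x) - 'd g x (w k)) +
   'd g x (w k))); last first.
  by apply/funext => k; rewrite subrK.
apply: cvgD; last first.
  have dc : {for u, continuous ('d g x)} by exact: diff_continuous.
  exact: (continuous_cvg _ dc wcvg).
apply/cvgr0Pnorm_lt => e e0.
have u1 : 0 < `|u| + 1 by rewrite ltr_wpDl.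
have e'0 : 0 < e / (`|u| + 1) by rewrite !divr_gt0.
have small : \forall k \near \oo,
    `|(g \o shift x) (t k *: w k) - (cst (g x) + 'd g x) (t k *: w k)|
    <= e / (`|u| + 1) * `|t k *: w k|.
  by have /eqaddoP /(_ _ e'0) := diff_locally dg; exact: tw0.
near=> k.
have -> : 'd g x (w k) = (t k)^-1 *: 'd g x (t k *: w k).
  by rewrite linearZ scalerK ?gt_eqF.
rewrite -scalerBr normrZ.
rewrite gtr0_norm ?invr_gt0// mulrC ltr_pdivrMr//.
have -> : g (x + t k *: w k) - g x - 'd g x (t k *: w k) =
    (g \o shift x) (t k *: w k) - (cst (g x) + 'd g x) (t k *: w k).
  by rewrite /= opprD addrA [X in g X]addrC.
apply: (@le_lt_trans _ _ (e / (`|u| + 1) * `|t k *: w k|)); first by near: k.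
rewrite normrZ gtr0_norm// mulrCA mulrC ltr_pM2r// -mulrA gtr_pMr// mulrC.
rewrite ltr_pdivrMr// mul1r.
by near: k; apply: (cvgr_norm_lt _ wcvg); rewrite ltrDl.
Unshelve. all: by end_near. Qed.

End Calculus.

Section SecondOrder.
Context {R : realType} {V : euclideanType R}.

Lemma is_derive_line (g : V -> R) (x w : V) (s : R) :
  differentiable g (x + s *: w) ->
  is_derive s 1 (fun r : R => g (x + r *: w)) ('d g (x + s *: w) w).
Proof.
move=> dg.
have la : is_diff s (fun r : R => x + r *: w) ( *:%R^~ w).
  by apply: is_diff_eq; rewrite ?add0r.
have da : differentiable (g \o (fun r : R => x + r *: w)) s.
  by apply: differentiable_comp.
apply: DeriveDef; first exact: diff_derivable.
by rewrite (deriveE _ da) diff_comp//= diff_val /= scale1r.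
Qed.

(** Cauchy's mean value theorem for the restriction of [g] to a line against
    the square function. *)
Lemma quadratic_mean_value (g : V -> R) (x w : V) (t : R) :
  0 < t -> (forall y, differentiable g y) ->
  exists2 s, 0 < s < t &
    (t ^+ 2)^-1 * (g (x + t *: w) - g x) = s^-1 * 'd g (x + s *: w) w / 2.
Proof.
move=> t0 dg; pose c := (t ^+ 2)^-1 * (g (x + t *: w) - g x).
(* [c] is chosen so that [psi] takes the same value at [0] and [t]. *)
pose psi : R -> R := (fun r : R => g (x + r *: w)) - c *: (@id R ^+ 2).
have dpsi (s : R) : is_derive s 1 psi ('d g (x + s *: w) w - c * (2 * s)).
  have ? := @is_derive_line g x w s (dg _).
  apply: is_derive_eq.
  by rewrite expr1 /GRing.scale/= mulr1.
have [|||s st ds] := @Rolle R psi 0 t t0.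
- by move=> s _; have [] := dpsi s.
- apply: derivable_within_continuous => s _; by have [] := dpsi s.
- rewrite /psi !fctE /= scale0r addr0 expr0n scaler0 subr0 /GRing.scale/= /c.
  by rewrite mulrAC mulVf ?mul1r ?opprB ?subrKC// expf_neq0// gt_eqF.
exists s; first by rewrite in_itv in st.
have s0 : s != 0 by move: st; rewrite in_itv/= => /andP[/gt_eqF ->].
have [_ e1] := dpsi s; have [_ e2] := ds.
have /eqP : 'd g (x + s *: w) w - c * (2 * s) = 0 by rewrite -e1 e2.
by rewrite subr_eq0 => /eqP ->; rewrite -/c mulrCA mulrCA; field.
Qed.

(** Since ['d g x = 0], the mean value form of the second-order quotient is
    itself a first-order quotient of ['d g], to which [diff_quotient_cvg]
    applies, one fixed test vector at a time. *)
Lemma second_order_quotient_cvg (g : V -> R) (x u : V) (t : nat -> R)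
    (w : nat -> V) :
  (forall y, differentiable g y) ->
  (forall v, differentiable (fun y => 'd g y v) x) ->
  (forall v, 'd g x v = 0) ->
  (forall k, 0 < t k) -> t @ \oo --> (0 : R) -> w @ \oo --> u ->
  (t k ^+ 2)^-1 * (g (x + t k *: w k) - g x) @[k --> \oo]
    --> diff2 g x u u / 2.
Proof.
move=> dg ddg dg0 t0 tcvg wcvg.
have /choice [s sP] : forall k, exists s, 0 < s < t k /\
    (t k ^+ 2)^-1 * (g (x + t k *: w k) - g x) =
    s^-1 * 'd g (x + s *: w k) (w k) / 2.
  by move=> k; have [s] := quadratic_mean_value _ x (w k) _ (t0 k) dg; exists s.
have s0 k : 0 < s k by have [/andP[]] := sP k.
have scvg : s @ \oo --> (0 : R).
  apply: (squeeze_cvgr _ (cvg_cst 0) tcvg); apply: nearW => k.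
  by have [/andP[s0k /ltW ->]] := sP k; rewrite ltW.
have quot v : (s k)^-1 * 'd g (x + s k *: w k) v @[k --> \oo] -->
    diff2 g x u v.
  have := diff_quotient_cvg _ x u s w (ddg v) s0 scvg wcvg.
  by under eq_cvg do rewrite dg0 subr0.
under eq_cvg do rewrite (sP _).2.
apply: cvgMl.
(* The test vector [w k] also moves: it is replaced with [u], and the error
   [w k - u] is expanded in a basis, so that only fixed test vectors remain. *)
have -> : (fun k => (s k)^-1 * 'd g (x + s k *: w k) (w k)) = (fun k =>
    (s k)^-1 * 'd g (x + s k *: w k) u +
    \sum_i v2r (w k - u) 0 i *
      ((s k)^-1 * 'd g (x + s k *: w k) (r2v (delta_mx 0 i)))).
  apply/funext => k; set y := x + _.
  rewrite -[w k in LHS](subrK u) addrC linearD mulrDr; congr (_ + _).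
  rewrite -[in LHS](v2rK (w k - u)) r2v_sum linear_sum mulr_sumr.
  by apply: eq_bigr => i _; rewrite linearZ mulrCA.
rewrite -[diff2 _ _ _ _]addr0; apply: cvgD; first exact: quot.
have sum0 : \sum_(i < dim V) (0 : R) = 0 by rewrite big1.
rewrite -[X in _ --> X]sum0; apply: cvg_fin_sum => i.
rewrite -(mul0r (diff2 g x u (r2v (delta_mx 0 i)))).
apply: cvgM; last exact: quot.
have -> : 0 = v2r (u - u) 0 i by rewrite subrr linear0 mxE.
have wu : (fun k => w k - u) @ \oo --> u - u.
  by apply: cvgB => //; exact: cvg_cst.
have c2 : {for u - u, continuous (fun z : V => v2r z 0 i)}.
  exact: (continuous_comp (v2r_continuous _) (@coord_continuous _ _ _ _ _ _)).
exact: (continuous_cvg _ c2 wu).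
Qed.

End SecondOrder.

(** * Normals to the cone of positive semidefinite matrices *)

Section InnerProduct.
Context {R : realType} {V : euclideanType R}.

Lemma inner_is_linear (y : V) : linear (inner y : V -> R).
Proof. by move=> a u v; rewrite innerC innerDl innerZl !(innerC _ y). Qed.

HB.instance Definition _ (y : V) :=
  GRing.isLinear.Build R V R _ (inner y : V -> R) (inner_is_linear y).

Lemma innerDr (y u v : V) : inner y (u + v) = inner y u + inner y v.
Proof. exact: linearD. Qed.

Lemma innerZr (y : V) (a : R) (u : V) : inner y (a *: u) = a * inner y u.
Proof. exact: linearZ. Qed.

Lemma inner_cvg (y : V) (w : nat -> V) (u : V) :
  w @ \oo --> u -> inner y (w k) @[k --> \oo] --> inner y u.
Proof.
move=> wu.
have c : {for u, continuous (inner y : V -> R)}.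
  exact: linear_continuous_findim.
exact: (continuous_cvg _ c wu).
Qed.

End InnerProduct.

Section Semidefinite.
Context {R : realType} {m : nat}.
Implicit Types (A Y V Q : 'Sym[R]_m) (B P : 'M[R]_m).

(** The value is meaningful for symmetric [B] only. *)
Definition to_sym B : 'Sym[R]_m := vsproj (sym_space R m) B.

Lemma to_symK B : B^T = B -> sym_val (to_sym B) = B.
Proof. by move=> /sym_spaceP; exact: vsprojK. Qed.

Lemma sym_valD A Q : sym_val (A + Q) = sym_val A + sym_val Q.
Proof. exact: linearD. Qed.

Lemma sym_valZ (a : R) A : sym_val (a *: A) = a *: sym_val A.
Proof. exact: linearZ. Qed.

Lemma frob_is_linear B : linear (frob B : 'M[R]_m -> R).
Proof. by move=> a C D; rewrite /frob mulmxDr -scalemxAr !linearD linearZ. Qed.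

HB.instance Definition _ B :=
  GRing.isLinear.Build R 'M[R]_m R _ (frob B : 'M[R]_m -> R) (frob_is_linear B).

Lemma frobD B C D : frob B (C + D) = frob B C + frob B D.
Proof. exact: linearD. Qed.

Lemma frobN B C : frob B (- C) = - frob B C.
Proof. exact: linearN. Qed.

Lemma frobZ B (a : R) C : frob B (a *: C) = a * frob B C.
Proof. exact: linearZ. Qed.

Lemma frob_tr Y B : frob (sym_val Y) B^T = frob (sym_val Y) B.
Proof.
by rewrite /frob -mxtrace_tr trmx_mul trmxK sym_valT mxtrace_mulC.
Qed.

Lemma psd_coneD A Q : psd_cone A -> psd_cone Q -> psd_cone (A + Q).
Proof.
by move=> Ap Qp v; rewrite sym_valD mulmxDr mulmxDl mxE addr_ge0 ?Ap ?Qp.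
Qed.

Lemma psd_coneZ (a : R) A : 0 <= a -> psd_cone A -> psd_cone (a *: A).
Proof.
by move=> a0 Ap v; rewrite sym_valZ -scalemxAr -scalemxAl mxE mulr_ge0.
Qed.

Lemma congr_symK Q B : sym_val (to_sym (B^T *m sym_val Q *m B)) =
  B^T *m sym_val Q *m B.
Proof. by rewrite to_symK// !trmx_mul trmxK sym_valT mulmxA. Qed.

Lemma psd_cone_congr Q B :
  psd_cone Q -> psd_cone (to_sym (B^T *m sym_val Q *m B)).
Proof.
by move=> Qp v; rewrite congr_symK -!mulmxA mulmxA -trmx_mul mulmxA; exact: Qp.
Qed.

(** A convex cone is contained in its tangent cones. *)
Lemma normal_psd_le0 A Y Q : psd_cone A -> normal_cone psd_cone A Y ->
  psd_cone Q -> inner Y Q <= 0.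
Proof.
move=> Ap AY Qp; apply: AY; exists (fun k => k.+1%:R^-1), (fun=> Q); split.
- by move=> k; rewrite invr_gt0.
- exact: harmonic_cvg0.
- exact: cvg_cst.
- by move=> k; apply: psd_coneD => //; apply: psd_coneZ; rewrite ?invr_ge0.
Qed.

(** The velocity at [t = 0] of the curve [(1 + t B)^T A (1 + t B)], which stays
    in the cone. *)
Lemma tangent_sandwich A B : psd_cone A ->
  tangent_cone psd_cone A (to_sym (B^T *m sym_val A + sym_val A *m B)).
Proof.
move=> Ap; set Z := to_sym _; pose Q := to_sym (B^T *m sym_val A *m B).
exists (fun k => k.+1%:R^-1), (fun k => Z + k.+1%:R^-1 *: Q); split.
- by move=> k; rewrite invr_gt0.
- exact: harmonic_cvg0.
- rewrite -[X in _ --> X]addr0 -[X in _ --> _ + X](scale0r Q); apply: cvgD.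
    exact: cvg_cst.
  by apply: cvgZr_tmp; exact: harmonic_cvg0.
move=> k; set t := _^-1.
suff -> : A + t *: (Z + t *: Q) =
    to_sym ((1%:M + t *: B)^T *m sym_val A *m (1%:M + t *: B)).
  exact: psd_cone_congr.
apply: sym_val_inj; rewrite congr_symK !(sym_valD, sym_valZ).
rewrite congr_symK to_symK; last first.
  by rewrite linearD/= !trmx_mul trmxK sym_valT addrC.
rewrite [(_ + _)^T]linearD/= [(t *: _)^T]linearZ/= trmx1.
rewrite !mulmxDl !mulmxDr !mul1mx !mulmx1.
rewrite -!scalemxAl -!scalemxAr !scalerDr -!addrA; congr (_ + _).
rewrite [RHS]addrCA; congr (_ + (_ + _)).
Qed.

(** Normality says that [Y A = 0], in the weak form used below: the tangent
    vectors of [tangent_sandwich] come in opposite pairs [B], [- B], and their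
    pairing with [Y] is [2 <Y, A B>]. *)
Lemma normal_frob_mul0 A Y B : psd_cone A -> normal_cone psd_cone A Y ->
  frob (sym_val Y) (sym_val A *m B) = 0.
Proof.
move=> Ap AY.
have le0 C : frob (sym_val Y) (sym_val A *m C) <= 0.
  have := AY _ (tangent_sandwich A C Ap).
  rewrite inner_symE to_symK; last first.
    by rewrite linearD/= !trmx_mul trmxK sym_valT addrC.
  rewrite linearD/= -{1}(sym_valT A) -trmx_mul frob_tr -mulr2n.
  by rewrite pmulrn_lle0.
apply/eqP; rewrite eq_le le0/=.
by have := le0 (- B); rewrite mulmxN linearN/= oppr_le0.
Qed.

Lemma moore_penrose_sym A :
  (moore_penrose (sym_val A))^T = moore_penrose (sym_val A).
Proof.
have [ABA BAB AB BA] := moore_penroseP (sym_val A).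
apply: (is_moore_penrose_uniq (A := sym_val A)); last exact: moore_penroseP.
set P := moore_penrose _ in ABA BAB AB BA *.
split.
- by apply: trmx_inj; rewrite !trmx_mul trmxK !sym_valT mulmxA ABA.
- by apply: trmx_inj; rewrite !trmx_mul trmxK !sym_valT mulmxA BAB.
- by rewrite trmx_mul trmxK sym_valT -BA trmx_mul sym_valT.
- by rewrite trmx_mul trmxK sym_valT -AB trmx_mul sym_valT.
Qed.

(** The expansion of [<Y, M^T W M> <= 0] for [W = A + t V'] and
    [M = 1 - t P V]. In the cross terms, linear in [P V], the contribution of
    [A] disappears by [normal_frob_mul0]; in the quadratic term it becomes
    [V P V] by the identity [P A P = P]. *)
Lemma normal_second_order_bound A Y V V' (t : R) :
  let P := moore_penrose (sym_val A) in
  psd_cone A -> normal_cone psd_cone A Y -> psd_cone (A + t *: V') ->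
  inner Y (A + t *: V') <= t ^+ 2 *
    (2 * frob (sym_val Y) (sym_val V' *m (P *m sym_val V))
     - frob (sym_val Y) (sym_val V *m P *m sym_val V)
     - t * frob (sym_val Y) (sym_val V *m P *m sym_val V' *m (P *m sym_val V))).
Proof.
move=> P Ap AY Wp; set N := P *m sym_val V.
have NT : N^T = sym_val V *m P.
  by rewrite trmx_mul sym_valT moore_penrose_sym.
have := normal_psd_le0 A Y _ Ap AY (psd_cone_congr _ (1%:M - t *: N) Wp).
rewrite !inner_symE congr_symK.
set W := sym_val (A + t *: V').
have WT : W^T = W by exact: sym_valT.
have WE : W = sym_val A + t *: sym_val V' by rewrite /W sym_valD sym_valZ.
clearbody W.
have -> : (1%:M - t *: N)^T *m W *m (1%:M - t *: N) =
   W - t *: (W *m N)^T - t *: (W *m N) + t ^+ 2 *: (N^T *m W *m N).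
  rewrite [(_ - _)^T]linearB/= [(t *: _)^T]linearZ/= trmx1.
  rewrite !mulmxBl !mulmxBr !mul1mx !mulmx1.
  rewrite [(W *m N)^T]trmx_mul WT -!scalemxAl -!scalemxAr scalerA -expr2.
  rewrite opprB addrA.
  by rewrite addrAC; congr (_ + _); exact: addrAC.
rewrite !(frobD, frobN, frobZ) frob_tr.
have WN : frob (sym_val Y) (W *m N) = t * frob (sym_val Y) (sym_val V' *m N).
  rewrite WE mulmxDl -scalemxAl frobD frobZ.
  by rewrite normal_frob_mul0// add0r.
have NWN : frob (sym_val Y) (N^T *m W *m N) =
    frob (sym_val Y) (sym_val V *m P *m sym_val V) +
    t * frob (sym_val Y) (sym_val V *m P *m sym_val V' *m N).
  rewrite WE mulmxDr mulmxDl -scalemxAr -scalemxAl.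
  rewrite frobD frobZ NT; congr (frob _ _ + _).
  have [_ PAP _ _] := moore_penroseP (sym_val A).
  by rewrite /N -[P in RHS]PAP !mulmxA.
rewrite WN NWN.
move=> h; rewrite -subr_le0; apply: le_trans h; rewrite le_eqVlt; apply/orP.
by left; apply/eqP; ring.
Qed.

(** As [Z --> V], the first two terms of [normal_second_order_bound] combine
    to [2 <Y, V P V> - <Y, V P V>] and the last one vanishes. *)
Lemma normal_second_order_limit A Y V (t : nat -> R) (Z : nat -> 'Sym[R]_m)
    (c : nat -> R) (l : R) :
  psd_cone A -> normal_cone psd_cone A Y ->
  (forall k, 0 < t k) -> t @ \oo --> (0 : R) -> Z @ \oo --> V ->
  (forall k, psd_cone (A + t k *: Z k)) ->
  (forall k, c k <= (t k ^+ 2)^-1 * inner Y (A + t k *: Z k)) ->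
  c @ \oo --> l ->
  l <= frob (sym_val Y)
         (sym_val V *m moore_penrose (sym_val A) *m sym_val V).
Proof.
move=> Ap AY t0 tcvg ZV Wp cle ccvg; set P := moore_penrose _.
have lin L N :
    linear (fun U : 'Sym[R]_m => frob (sym_val Y) (L *m sym_val U *m N)).
  move=> a U U'; rewrite sym_valD sym_valZ mulmxDr mulmxDl.
  by rewrite -scalemxAr -scalemxAl frobD frobZ.
have cvgf L N : frob (sym_val Y) (L *m sym_val (Z k) *m N) @[k --> \oo] -->
    frob (sym_val Y) (L *m sym_val V *m N).
  pose h : {linear 'Sym[R]_m -> R} := HB.pack
    (fun U : 'Sym[R]_m => frob (sym_val Y) (L *m sym_val U *m N))
    (GRing.isLinear.Build R _ R _ _ (lin L N)).
  have hc : {for V, continuous h} by exact: linear_continuous_findim.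
  exact: (continuous_cvg _ hc ZV).
pose d k := 2 * frob (sym_val Y) (1%:M *m sym_val (Z k) *m (P *m sym_val V))
     - frob (sym_val Y) (sym_val V *m P *m sym_val V)
     - t k * frob (sym_val Y)
               (sym_val V *m P *m sym_val (Z k) *m (P *m sym_val V)).
apply: (ler_cvg_to ccvg (_ : d @ \oo --> _)); last first.
  apply: nearW => k; apply: le_trans (cle k) _.
  rewrite ler_pdivrMl ?exprn_gt0// /d mul1mx.
  exact: normal_second_order_bound.
have -> : frob (sym_val Y) (sym_val V *m P *m sym_val V) =
  2 * frob (sym_val Y) (1%:M *m sym_val V *m (P *m sym_val V))
     - frob (sym_val Y) (sym_val V *m P *m sym_val V)
     - 0 * frob (sym_val Y) (sym_val V *m P *m sym_val V *m (P *m sym_val V)).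
  by rewrite mul1mx mulmxA; ring.
by apply: cvgB; [apply: cvgB; [apply: cvgMr|exact: cvg_cst]|apply: cvgM].
Qed.

End Semidefinite.

(** * From directions to a neighbourhood *)

Section Growth.
Context {R : realType}.

Lemma compact_sphere_uniform {V : euclideanType R} (Q : R -> V -> Prop) :
  (forall u, `|u| = 1 ->
    exists2 r : R, 0 < r & forall w, `|u - w| < r -> Q r w) ->
  (forall (r s : R) w, 0 < s -> s <= r -> Q r w -> Q s w) ->
  exists2 r : R, 0 < r & forall u, `|u| = 1 -> Q r u.
Proof.
move=> loc mono.
have /compact_near_coveringP cov := @compact_unit_sphere R V.
have : \forall r \near (0 : R)^'+, [set v : V | `|v| = 1] `<=` Q r.
  apply: cov => u /= /loc[r r0 Qr].
  exists ([set w : V | `|u - w| < r], [set s | 0 < s /\ s <= r]) => /=.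
    split; first by apply/nbhs_normP; exists r.
    near=> s; split; near: s; first exact: nbhs_right_gt.
    exact: nbhs_right_le.
  by move=> [w s] /= [uw [s0 sr]]; apply: mono sr (Qr _ uw).
move=> covr; near (0 : R)^'+ => r; exists r => // u u1.
have : [set v : V | `|v| = 1] `<=` Q r by near: r.
exact.
Unshelve. all: by end_near. Qed.

(** Every [y != x] lies on the ray from [x] in the unit direction
    [(y - x) / |y - x|], at distance [|y - x|]. *)
Lemma quadratic_growth_of_rays {V : euclideanType R} (h : V -> R) (x : V) :
  (forall u, `|u| = 1 -> exists2 r : R, 0 < r &
    forall w t, `|u - w| < r -> 0 < t < r -> r * t ^+ 2 <= h (x + t *: w)) ->
  0 <= h x ->
  exists eps beta : R, [/\ 0 < eps, 0 < beta &
    forall y, `|y - x| <= eps -> beta * `|y - x| ^+ 2 <= h y].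
Proof.
move=> loc hx.
have [|r s w s0 sr Qr t /andP[t0 ts]|r r0 rP] :=
  compact_sphere_uniform (fun r w => forall t, 0 < t < r ->
     r * t ^+ 2 <= h (x + t *: w)).
- by move=> u /loc[r r0 rP]; exists r => // w uw t; exact: rP.
- apply: le_trans (Qr t _); last by rewrite t0 (lt_le_trans ts).
  by rewrite ler_wpM2r// sqr_ge0.
exists (r / 2), r; split=> //; first by rewrite divr_gt0.
move=> y yx; have [->|yNx] := eqVneq y x.
  by rewrite subrr normr0 expr0n/= mulr0.
have n0 : 0 < `|y - x| by rewrite normr_gt0 subr_eq0.
have := rP (`|y - x|^-1 *: (y - x)) _ `|y - x| _.
rewrite scalerA mulfV ?gt_eqF// scale1r subrKC; apply.
- by rewrite normrZ normfV normr_id mulVf// gt_eqF.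
- rewrite n0/=; apply: le_lt_trans yx _.
  by rewrite ltr_pdivrMr// ltr_pMr// ltr1n.
Qed.

Lemma distance_lt {V : normedModType R} (S : set V) (z : V) (r : R) :
  S !=set0 -> distance S z < r -> exists2 w, S w & `|w - z| < r.
Proof.
move=> [w Sw] /inf_lt[|_ [v Sv <-] vr]; last by exists v.
by exists `|w - z|; exists w.
Qed.

End Growth.

(** * Growth near one direction *)

Section Directions.
Context {R : realType} {m : nat} {X : euclideanType R}.
Variables (f : X -> R) (F : X -> 'Sym[R]_m) (xbar : X).
Hypotheses (f2 : twice_continuously_differentiable f)
  (F2 : twice_continuously_differentiable F).

Lemma inner_diff (Y : 'Sym[R]_m) (g : X -> 'Sym[R]_m) (x : X) :
  differentiable g x ->
  is_diff x (fun z => inner Y (g z)) (fun v => inner Y ('d g x v)).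
Proof.
move=> dg; have c : continuous (inner Y : 'Sym[R]_m -> R).
  exact: linear_continuous_findim.
have dY : differentiable (inner Y : 'Sym[R]_m -> R) (g x).
  exact: linear_differentiable.
apply: DiffDef; first exact: (differentiable_comp dg dY).
by rewrite (diff_comp dg dY) (diff_lin _ c).
Qed.

Lemma lagrangian_diff (alpha : R) (Y : 'Sym[R]_m) (x : X) :
  is_diff x (fun z => lagrangian f F alpha z Y)
    (fun v => alpha * 'd f x v + inner Y ('d F x v)).
Proof.
have [df _ _] := f2; have [dF _ _] := F2.
have ? := inner_diff Y F x (dF x).
have ? : is_diff x f ('d f x) by exact: differentiableP.
have -> : (fun z => lagrangian f F alpha z Y) =
  (alpha *: f) + (fun z => inner Y (F z)) by [].
exact: is_diff_eq.
Qed.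

Lemma lagrangian_diff2 (alpha : R) (Y : 'Sym[R]_m) (x v : X) :
  differentiable (fun y => 'd (fun z => lagrangian f F alpha z Y) y v) x.
Proof.
have [_ ddf _] := f2; have [_ ddF _] := F2.
have -> : (fun y => 'd (fun z => lagrangian f F alpha z Y) y v) =
    alpha *: (fun y => 'd f y v) + (fun y => inner Y ('d F y v)).
  by apply/funext => y; have ? := lagrangian_diff alpha Y y; rewrite diff_val.
apply: differentiableD; first exact: differentiableZ.
by have [] := inner_diff Y _ x (ddF v x).
Qed.

(** The contradiction argument. Failure of the bound for the constants
    [1 / (k + 1)] provides the sequences [w], [t] and the points
    [x k = xbar + t k *: w k]. *)
Lemma ray_growth (u : X) :
  psd_cone (F xbar) ->
  (critical_cone f F xbar u ->
    exists (alpha : R) (Y : 'Sym[R]_m),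
      [/\ 0 <= alpha,
          multipliers f F alpha xbar u Y &
          diff2 (fun x => lagrangian f F alpha x Y) xbar u u >
          2 * frob (sym_val Y)
                (sym_val ('d F xbar u) *m moore_penrose (sym_val (F xbar))
                   *m sym_val ('d F xbar u))]) ->
  exists2 r : R, 0 < r & forall w t, `|u - w| < r -> 0 < t < r ->
    r * t ^+ 2 <= Num.max (f (xbar + t *: w) - f xbar)
                   (distance psd_cone (F (xbar + t *: w))).
Proof.
move=> Ap suff_u; apply: contrapT => none.
have [df _ _] := f2; have [dF _ _] := F2.
pose e k : R := k.+1%:R^-1.
have e0 k : 0 < e k by rewrite invr_gt0.
have ecvg : e @ \oo --> (0 : R) by exact: harmonic_cvg0.
have /choice[wt wtP] : forall k, exists p : X * R,
    [/\ `|u - p.1| < e k, 0 < p.2, p.2 < e k,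
      f (xbar + p.2 *: p.1) - f xbar < e k * p.2 ^+ 2 &
      distance psd_cone (F (xbar + p.2 *: p.1)) < e k * p.2 ^+ 2].
  move=> k; apply: contrapT => nok; apply: none; exists (e k) => // w t uw.
  move=> /andP[t0 te]; rewrite leNgt; apply/negP.
  rewrite gt_max => /andP[fl dl].
  by apply: nok; exists (w, t).
pose w k := (wt k).1; pose t k := (wt k).2; pose x k := xbar + t k *: w k.
have t0 k : 0 < t k by have [] := wtP k.
have te k : t k < e k by have [] := wtP k.
have tcvg : t @ \oo --> (0 : R).
  apply: (squeeze_cvgr _ (cvg_cst 0) ecvg); apply: nearW => k.
  by rewrite !ltW.
have wcvg : w @ \oo --> u.
  apply/cvgrPdist_lt => d d0; near=> k.
  have [/lt_trans uw _ _ _ _] := wtP k; apply: uw.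
  by near: k; apply: (cvgr_lt _ ecvg).
have f_small k : f (x k) - f xbar < e k * t k ^+ 2 by have [] := wtP k.
have /choice[W WP] : forall k, exists W, psd_cone W /\
    `|W - F (x k)| < e k * t k ^+ 2.
  move=> k; have [_ _ _ _ dl] := wtP k.
  have [|W Wp We] := distance_lt _ _ _ _ dl; last by exists W.
  by exists (F xbar).
(* [W k] is a semidefinite point near [F (x k)]; as [E] tends to zero, the
   perturbation is invisible at second order. *)
pose E k := (t k ^+ 2)^-1 *: (W k - F (x k)).
have Ecvg : E @ \oo --> (0 : 'Sym[R]_m).
  apply/cvgr0Pnorm_lt => d d0; near=> k.
  apply: (@lt_trans _ _ (e k)); last by near: k; apply: (cvgr_lt _ ecvg).
  rewrite normrZ gtr0_norm ?invr_gt0 ?exprn_gt0// mulrC.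
  by rewrite ltr_pdivrMr ?exprn_gt0//; have [] := WP k.
(* [Z k] is defined by [F xbar + t k *: Z k = W k], and exhibits the derivative
   of [F] as a tangent vector. *)
pose Z k := (t k)^-1 *: (F (x k) - F xbar) + t k *: E k.
have WE k : F xbar + t k *: Z k = W k.
  have tk : t k != 0 by rewrite gt_eqF.
  rewrite /Z /E scalerDr !scalerA mulfV// -expr2 mulfV ?expf_neq0// !scale1r.
  by rewrite addrA subrKC subrKC.
have Zp k : psd_cone (F xbar + t k *: Z k) by rewrite WE; have [] := WP k.
have Zcvg : Z @ \oo --> 'd F xbar u.
  rewrite -[X in _ --> X]addr0 -[X in _ --> _ + X](scale0r (0 : 'Sym[R]_m)).
  by apply: cvgD; [exact: diff_quotient_cvg|exact: cvgZ].
have crit : critical_cone f F xbar u.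
  split; last by exists t, Z.
  apply: (ler_cvg_to (diff_quotient_cvg f xbar u t w (df _) t0 tcvg wcvg)
    (_ : (fun k => e k * t k) @ \oo --> (0 : R))).
    by rewrite -[X in _ --> X](mul0r (0 : R)); exact: cvgM.
  apply: nearW => k; rewrite /GRing.scale/= ler_pdivrMl// ltW//.
  by rewrite mulrCA -expr2; exact: f_small.
have [alpha [Y [alpha0 [AY _ dL0] Lgt]]] := suff_u crit.
set L := fun z => lagrangian f F alpha z Y in dL0 Lgt.
have dL y : differentiable L y by have [] := lagrangian_diff alpha Y y.
have Lcvg := second_order_quotient_cvg L xbar u t w dL
  (fun v => lagrangian_diff2 alpha Y xbar v) dL0 t0 tcvg wcvg.
have YA : inner Y (F xbar) = 0.
  by rewrite inner_symE -[sym_val (F xbar)]mulmx1 normal_frob_mul0.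
(* A lower bound for [<Y, W k> / t k ^ 2]: in the Lagrangian increment, the
   increment of [f] is at most [e k * t k ^ 2], and [alpha] is nonnegative. *)
pose c k := (t k ^+ 2)^-1 * (L (x k) - L xbar) - alpha * e k + inner Y (E k).
have ccvg : c @ \oo --> diff2 L xbar u u / 2 - alpha * 0 + inner Y 0.
  by apply: cvgD; [apply: cvgB => //; exact: cvgMr|exact: inner_cvg].
rewrite linear0 mulr0 subr0 addr0 in ccvg.
have := @normal_second_order_limit _ _ _ _ _ _ _ _ _
  Ap AY t0 tcvg Zcvg Zp _ ccvg.
rewrite leNgt ltr_pdivlMr// [_ * 2]mulrC Lgt => absurd.
suff : false by []; apply: absurd => k; rewrite /c.
have t2 : 0 < t k ^+ 2 by rewrite exprn_gt0.
have -> : inner Y (F xbar + t k *: Z k) =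
    L (x k) - L xbar - alpha * (f (x k) - f xbar) + t k ^+ 2 * inner Y (E k).
  rewrite WE -[W k in LHS](subrK (F (x k))) innerDr /E innerZr.
  by rewrite mulrA mulfV ?gt_eqF// mul1r /L /lagrangian YA; ring.
rewrite [leRHS]mulrDr mulKf ?gt_eqF// lerD2r [leRHS]mulrBr lerD2l lerN2.
by rewrite mulrCA ler_wpM2l// ler_pdivrMl// mulrC ltW.
Unshelve. all: by end_near. Qed.

End Directions.

Theorem corollary3p3 (R : realType) (m : nat) (X : euclideanType R)
    (f : X -> R) (F : X -> 'Sym[R]_m) (xbar : X) :
  (2 <= m)%N ->
  twice_continuously_differentiable f ->
  twice_continuously_differentiable F ->
  feasible_set F xbar ->
  (forall u : X, critical_cone f F xbar u -> u <> 0 ->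
    exists (alpha : R) (Y : 'Sym[R]_m),
      [/\ 0 <= alpha,
          multipliers f F alpha xbar u Y &
          diff2 (fun x => lagrangian f F alpha x Y) xbar u u >
          2 * frob (sym_val Y)
                (sym_val ('d F xbar u) *m moore_penrose (sym_val (F xbar))
                   *m sym_val ('d F xbar u))]) ->
  exists eps beta : R, [/\ 0 < eps, 0 < beta &
    forall x : X, `|x - xbar| <= eps ->
      Num.max (f x - f xbar) (distance psd_cone (F x))
        >= beta * `|x - xbar| ^+ 2].
Proof.
move=> _ f2 F2 xbar_feas suff_xbar.
pose h x := Num.max (f x - f xbar) (distance psd_cone (F x)).
apply: (quadratic_growth_of_rays h); last by rewrite le_max subrr lexx.
move=> u u1; apply: ray_growth => // u_crit; apply: suff_xbar => // u0.
by move: u1; rewrite u0 normr0 => /esym/eqP; rewrite oner_eq0.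
Qed.
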